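(* Let $A_\mu\in\mathbb{R}^{n\times n}$ be symmetric positive definite, $\Omega\in\mathbb{R}^{n\times l}$, and let $\Pi$ be the orthogonal projector onto $\mathrm{range}(A_\mu\Omega)$. Let $E=(I-\Pi)A_\mu(I-\Pi)$, let $\tau\in\mathbb R$ and define the preconditioner $$P=A_\mu^{-1}\big((I-\Pi)A_\mu(I-\Pi)+\tau\Pi\big).$$ Let $\rho\ge1$. If $\rho^{-1}\lambda_{\min}(A_\mu)\le\tau\le\rho\|E\|$, then $$\mathrm{cond}(A_\mu P)\le\rho\,\frac{\|E\|}{\lambda_{\min}(A_\mu)} .$$
   Context: $\|\cdot\|$ is the spectral norm, $\lambda_{\min}$ the smallest eigenvalue, and $\mathrm{cond}(B)$ is the ratio of the largest to the smallest singular value of $B$. In the paper $A_\mu=A+\mu I$ with $\mu\in\mathbb R$. *)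

(* Defs.v *)
From HB Require Import structures.
From mathcomp Require Import all_boot all_order all_algebra.
From mathcomp Require Import classical_sets reals constructive_ereal.

Set Implicit Arguments.
Unset Strict Implicit.
Unset Printing Implicit Defensive.

Import Order.TTheory GRing.Theory Num.Theory.
Local Open Scope classical_set_scope.
Local Open Scope ring_scope.

Section MatrixNotions.
Variables (R : realType) (n : nat).
Implicit Types (B P : 'M[R]_n) (x : 'cV[R]_n).

Definition enorm x : R := Num.sqrt (\sum_(i < n) x i 0 ^+ 2).

(* Matrix norm induced by the Euclidean norm. *)
Definition spectral_norm B : R :=
  sup [set enorm (B *m x) | x in [set x | enorm x <= 1]].

Definition spd B : Prop :=
  B^T = B /\ forall x, x != 0 -> 0 < (x^T *m B *m x) 0 0.

(* The sets below are finite, so whenever they are nonempty the infimum and the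
   supremum are a minimum and a maximum. [lambda_min] ranges over the real
   eigenvalues only; for a symmetric matrix these are all the eigenvalues. *)
Definition lambda_min B : R := inf [set a : R | eigenvalue B a].

Definition singular_values B : set R :=
  [set Num.sqrt a | a in [set a : R | eigenvalue (B^T *m B) a]].

Definition sigma_max B : R := sup (singular_values B).
Definition sigma_min B : R := inf (singular_values B).

(* Division by 0 is 0 in R, so singular matrices are given the conventional
   condition number +oo explicitly: a finite bound on [cond B] forces B to be
   nonsingular. *)
Definition cond B : \bar R :=
  if sigma_min B == 0 then +oo%E else (sigma_max B / sigma_min B)%:E.

(* The range (column space) of a matrix is the row space of its transpose. *)
Definition orth_projector_onto_range l (M : 'M[R]_(n, l)) P : Prop :=
  [/\ P *m P = P, P^T = P & (P^T :=: M^T)%MS].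

End MatrixNotions.

(* Main.v *)
(* A_mu P = E + tau Pi acts as tau on range Pi and as E on the orthogonal
   complement, where |E x| lies between lambda_min(A_mu) |x| and ||E|| |x| by the
   Rayleigh bound and Cauchy-Schwarz.  Hence all singular values lie in
   [min(lambda_min, tau), max(||E||, tau)].  Moreover Pi <> I, since otherwise
   E = 0 would force tau <= 0; so lambda_min <= ||E|| and the ratio of the two
   ends of this interval is at most rho ||E|| / lambda_min in every case. *)
Require Import Defs.
From mathcomp Require Import all_boot all_order all_algebra.
From mathcomp Require Import classical_sets reals constructive_ereal.
From mathcomp Require Import complex ring lra.

Set Implicit Arguments.
Unset Strict Implicit.
Unset Printing Implicit Defensive.

Import Order.TTheory GRing.Theory Num.Theory.
Local Open Scope ring_scope.

(* Diagonalizing S over R[i] in a unitary basis; the diagonal is real, and its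
   least entry is the eigenvalue sought. *)
Lemma rayleigh_min (R : rcfType) (n : nat) (S : 'M[R]_n) :
  (0 < n)%N -> S^T = S ->
  exists2 a : R, eigenvalue S a &
    forall x : 'cV_n, a * (x^T *m x) 0 0 <= (x^T *m S *m x) 0 0.
Proof.
case: n S => // n S _ S_sym.
pose f : {rmorphism R -> R[i]} := real_complex R.
pose Sc := map_mx f S.
have Sc_real : Sc \is a mxOver Num.real.
  by apply/mxOverP => i j; rewrite mxE; apply/complex_realP; exists (S i j).
have Sc_herm : Sc \is hermsymmx.
  apply: realsym_hermsym => //; apply/is_hermitianmxP.
  by rewrite expr0 scale1r map_mx_id // map_trmx S_sym.
have dr := hermitian_spectral_diag_real Sc_herm.
have /hermitian_normalmx/orthomx_spectralP ScE := Sc_herm.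
set U := spectralmx Sc in ScE; set d := spectral_diag Sc in dr ScE.
have U_unitary : U \is unitarymx by exact: spectral_unitarymx.
have U_unit := unitarymx_unit U_unitary.
pose e i := complex.Re (d 0 i).
have dE i : d 0 i = f (e i).
  by symmetry; apply: RRe_real; apply: (mxOverP dr).
pose k := [arg min_(i < ord0) e i]%O.
have k_min i : e k <= e i by rewrite /k; case: Order.TotalTheory.arg_minP => // j _; apply.
exists (e k).
  (* [eigenvalue] is about row vectors, and [Sc] is [invmx U] times the diagonal times [U], so row
     [k] of [U] is an eigenvector over [R[i]]; [eigenvalue_map] brings the eigenvalue back to
     [R]. *)
  rewrite -(eigenvalue_map f); apply/eigenvalueP; exists (row k U).
    rewrite -dE -/Sc ScE !mulmxA -row_mul mulmxV //.
    by rewrite row1 -rowE row_diag_mx -scalemxAl -rowE.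
  apply: contraTneq U_unit => Uk0; rewrite unitmxE.
  rewrite (expand_det_row _ k) big1 ?unitr0 // => j _.
  by have /rowP/(_ j) := Uk0; rewrite !mxE => ->; rewrite mul0r.
move=> x; pose y := U *m map_mx f x.
(* As [x] is real, conjugation fixes it, and the inverse of [U] is its conjugate transpose. Both
   quadratic forms thus become weighted sums of [|y i 0|^2]. *)
have yt : (map_mx f x)^T *m invmx U = map_mx Num.conj y^T.
  have xc : map_mx Num.conj (map_mx f x)^T = (map_mx f x)^T.
    by apply/matrixP => i j; rewrite !mxE; apply/CrealP/complex_realP; exists (x j i).
  by rewrite trmx_mul map_mxM invmx_unitary // xc.
have xSx : f ((x^T *m S *m x) 0 0) = \sum_i f (e i) * `|y i 0| ^+ 2.
  transitivity ((map_mx f (x^T *m S *m x)) 0 0); first by rewrite [RHS]mxE.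
  rewrite !map_mxM -map_trmx -/Sc ScE !mulmxA yt -mulmxA mxE.
  by apply: eq_bigr => i _; rewrite -/y mul_mx_diag !mxE -dE normCK; ring.
have xx : f ((x^T *m x) 0 0) = \sum_i `|y i 0| ^+ 2.
  transitivity ((map_mx f (x^T *m x)) 0 0); first by rewrite [RHS]mxE.
  rewrite map_mxM -map_trmx -[in X in _ *m X](mulKmx U_unit (map_mx f x)).
  rewrite -/y mulmxA yt mxE; apply: eq_bigr => i _.
  by rewrite !mxE normCK mulrC.
rewrite -lecR; change (f (e k * (x^T *m x) 0 0) <= f ((x^T *m S *m x) 0 0)).
rewrite rmorphM xx xSx mulr_sumr; apply: ler_sum => i _.
by rewrite ler_wpM2r ?exprn_ge0 //; rewrite /f /= lecR.
Qed.

Section Euclidean.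
Variables (R : realType) (n : nat).
Implicit Types (B S : 'M[R]_n) (x y : 'cV[R]_n).

Lemma enorm_ge0 x : 0 <= enorm x.
Proof. exact: sqrtr_ge0. Qed.

Lemma sqr_enorm x : enorm x ^+ 2 = (x^T *m x) 0 0.
Proof.
rewrite sqr_sqrtr ?sumr_ge0 // => [|i _]; last exact: sqr_ge0.
by rewrite mxE; apply: eq_bigr => i _; rewrite mxE.
Qed.

Lemma enorm_gt0 x : x != 0 -> 0 < enorm x.
Proof.
move=> x0; rewrite sqrtr_gt0 lt_neqAle sumr_ge0 ?andbT; last first.
  by move=> i _; exact: sqr_ge0.
apply: contraNneq x0 => /esym/psumr_eq0P x_eq0; apply/eqP/colP => i.
by apply/eqP; rewrite mxE -sqrf_eq0 x_eq0 // => j _; exact: sqr_ge0.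
Qed.

Lemma enorm0 : enorm (0 : 'cV[R]_n) = 0.
Proof. by apply/eqP; rewrite -sqrf_eq0 sqr_enorm mulmx0 mxE. Qed.

Lemma enormZ a x : enorm (a *: x) = `|a| * enorm x.
Proof.
apply: (pexpIrn (n := 2)) => //; rewrite ?nnegrE ?mulr_ge0 ?enorm_ge0 //.
rewrite exprMn real_normK ?num_real // !sqr_enorm.
by rewrite [(a *: x)^T]linearZ /= -scalemxAl -scalemxAr scalerA mxE -expr2.
Qed.

Lemma sqr_enormD x y : x^T *m y = 0 ->
  enorm (x + y) ^+ 2 = enorm x ^+ 2 + enorm y ^+ 2.
Proof.
move=> xy0; have yx0 : y^T *m x = 0 by rewrite -[y^T *m x]trmxK trmx_mul trmxK xy0 trmx0.
by rewrite !sqr_enorm [(x + y)^T]linearD /= mulmxDl !mulmxDr xy0 yx0 addr0 add0r mxE.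
Qed.

(** Cauchy-Schwarz: the square of [enorm (enorm y *: x - enorm x *: y)] expands to
    [2 |x| |y| (|x| |y| - x^T y)]. Dividing by [|x| |y|] is why zero vectors are treated first. *)
Lemma dot_enorm_le x y : (x^T *m y) 0 0 <= enorm x * enorm y.
Proof.
have [->|/enorm_gt0 x0] := eqVneq x 0.
  by rewrite trmx0 mul0mx mxE mulr_ge0 ?enorm_ge0.
have [->|/enorm_gt0 y0] := eqVneq y 0.
  by rewrite mulmx0 mxE mulr_ge0 ?enorm_ge0.
have yx : (y^T *m x) 0 0 = (x^T *m y) 0 0.
  by rewrite -[in LHS](trmxK x) -trmx_mul mxE.
have := sqr_ge0 (enorm (enorm y *: x - enorm x *: y)).
rewrite sqr_enorm [(_ - _)^T]linearB /= ![(_ *: _)^T]linearZ /= mulmxBl !mulmxBr.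
rewrite -!scalemxAl -!scalemxAr !scalerA.
move: (sqr_enorm x) (sqr_enorm y) yx (mulr_gt0 x0 y0).
(* Generalizing the products keeps [mxE] from unfolding them into sums. *)
move: (x^T *m x) (y^T *m y) (x^T *m y) (y^T *m x) => X Y Z W.
rewrite !mxE => <- <- -> xy0 h.
by rewrite -(ler_pM2l xy0); nra.
Qed.

(** Rescale [x] to norm 1. The supremum is meaningful only once the set is bounded above, which
    follows from the Rayleigh bound for [- B^T B]. *)
Lemma enorm_mulmx_le_spectral_norm B x :
  (0 < n)%N -> enorm (B *m x) <= spectral_norm B * enorm x.
Proof.
move=> n0.
have sym : (- (B^T *m B))^T = - (B^T *m B) by rewrite linearN /= trmx_mul trmxK.
have [a _ aP] := rayleigh_min n0 sym.
have Bx z : enorm (B *m z) ^+ 2 <= - a * enorm z ^+ 2.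
  have := aP z; rewrite mulmxN mulNmx [(- _ : 'M_1) 0 0]mxE !sqr_enorm trmx_mul !mulmxA.
  lra.
have ub : has_ubound [set enorm (B *m z) | z in [set z | enorm z <= 1]]%classic.
  exists (Num.sqrt `|a|) => _ [z /= z1 <-].
  rewrite -(ger0_norm (enorm_ge0 (B *m z))) -sqrtr_sqr ler_wsqrtr //.
  apply: le_trans (Bx z) _; apply: le_trans (_ : `|a| * enorm z ^+ 2 <= _).
    by rewrite ler_wpM2r ?sqr_ge0 // ler_normr lexx orbT.
  by rewrite ler_piMr // expr_le1 // enorm_ge0.
have [->|/enorm_gt0 x0] := eqVneq x 0; first by rewrite mulmx0 !enorm0 mulr0.
rewrite -ler_pdivrMr //; apply: (ub_le_sup ub).
exists ((enorm x)^-1 *: x) => /=.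
  by rewrite enormZ ger0_norm ?invr_ge0 ?enorm_ge0 // mulVf ?gt_eqF.
by rewrite -scalemxAr enormZ ger0_norm ?invr_ge0 ?enorm_ge0 // mulrC.
Qed.

Lemma spd_unitmx B : spd B -> B \in unitmx.
Proof.
move=> [_ Bpos]; rewrite -unitmx_tr -row_free_unit -kermx_eq0.
apply/eqP/row_matrixP => i; rewrite row0; apply/eqP/negP => /negP v0.
have Bv : B *m (row i (kermx B^T))^T = 0.
  by rewrite -[B]trmxK -trmx_mul trmxK -row_mul mulmx_ker row0 trmx0.
have /Bpos : (row i (kermx B^T))^T != 0 by rewrite trmx_eq0.
by rewrite -mulmxA Bv mulmx0 mxE ltxx.
Qed.

Lemma lambda_min_rayleigh S : (0 < n)%N -> S^T = S ->
  eigenvalue S (lambda_min S) /\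
  forall x, lambda_min S * enorm x ^+ 2 <= (x^T *m S *m x) 0 0.
Proof.
move=> n0 Ssym; have [a Sa aP] := rayleigh_min n0 Ssym.
(* The Rayleigh bound, tested at an eigenvector, puts [a] below every eigenvalue; being one itself,
   [a] is the infimum. *)
suff -> : lambda_min S = a by split=> // x; rewrite sqr_enorm.
have lb : lbound [set b | eigenvalue S b]%classic a.
  move=> b /= /eigenvalueP[v vS v0].
  have := aP v^T; rewrite trmxK vS -scalemxAl [(_ *: _ : 'M_1) 0 0]mxE.
  have -> : (v *m v^T) 0 0 = enorm v^T ^+ 2 by rewrite sqr_enorm trmxK.
  by rewrite ler_pM2r // exprn_gt0 // enorm_gt0 // trmx_eq0.
apply/eqP; rewrite eq_le; apply/andP; split.
  by apply: ge_inf => //; exists a.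
by apply: lb_le_inf => //; exists a.
Qed.

Lemma spd_lambda_min_gt0 B : (0 < n)%N -> spd B -> 0 < lambda_min B.
Proof.
move=> n0 [Bsym Bpos].
have [/eigenvalueP[v vB v0] _] := lambda_min_rayleigh n0 Bsym.
have := Bpos v^T; rewrite trmx_eq0 trmxK vB -scalemxAl [(_ *: _ : 'M_1) 0 0]mxE => /(_ v0).
have -> : (v *m v^T) 0 0 = enorm v^T ^+ 2 by rewrite sqr_enorm trmxK.
by rewrite pmulr_lgt0 // exprn_gt0 // enorm_gt0 // trmx_eq0.
Qed.

(** Each singular value is the ratio [|B v| / |v|] at an eigenvector [v] of [B^T B], so it lies in
    [[L, U]]; [0 < L] rules out the infinite branch of [cond]. *)
Lemma cond_le B (L U : R) : (0 < n)%N -> 0 < L ->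
  (forall x, L * enorm x <= enorm (B *m x) <= U * enorm x) ->
  (cond B <= (U / L)%:E)%E.
Proof.
move=> n0 L0 LU.
have sym : (B^T *m B)^T = B^T *m B by rewrite trmx_mul trmxK.
have [a Ba _] := rayleigh_min n0 sym.
have sv0 : (singular_values B !=set0)%classic by exists (Num.sqrt a), a.
have svLU s : singular_values B s -> L <= s <= U.
  move=> [b /= /eigenvalueP[v vB v0] <-].
  have vT0 : 0 < enorm v^T by rewrite enorm_gt0 // trmx_eq0.
  have Bv : enorm (B *m v^T) = Num.sqrt b * enorm v^T.
    have Bv2 : enorm (B *m v^T) ^+ 2 = b * enorm v^T ^+ 2.
      by rewrite !sqr_enorm trmx_mul !trmxK mulmxA -(mulmxA v) vB -scalemxAl [(_ *: _ : 'M_1) 0 0]mxE.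
    (* Needed because [Num.sqrt] is 0 on negative numbers. *)
    have b0 : 0 <= b by rewrite -(pmulr_lge0 _ (exprn_gt0 2 vT0)) -Bv2 sqr_ge0.
    apply: (pexpIrn (n := 2)) => //; rewrite ?nnegrE ?mulr_ge0 ?enorm_ge0 ?sqrtr_ge0 //.
    by rewrite exprMn (sqr_sqrtr b0) Bv2.
  by have := LU v^T; rewrite Bv !ler_pM2r.
have minL : L <= sigma_min B by apply: lb_le_inf => // s /svLU/andP[].
have maxU : sigma_max B <= U by apply: ge_sup => // s /svLU/andP[].
have min0 : 0 < sigma_min B by lra.
rewrite /cond gt_eqF // lee_fin ler_pM ?invr_ge0 ?lef_pV2 //; last exact: ltW.
(* What remains is [0 <= sigma_max B], obtained through any singular value. *)
have [s sB] := sv0; apply: le_trans (_ : s <= _).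
  by have /andP[] := svLU s sB; lra.
by apply: ub_le_sup => //; exists U => t /svLU/andP[].
Qed.

End Euclidean.

Theorem proposition3p1 (R : realType) (n l : nat) (A : 'M[R]_n) (mu : R)
    (Omega : 'M[R]_(n, l)) (Pi : 'M[R]_n) (tau rho : R) :
  let Amu := A + mu%:M in
  let E := (1%:M - Pi) *m Amu *m (1%:M - Pi) in
  let P := invmx Amu *m ((1%:M - Pi) *m Amu *m (1%:M - Pi) + tau *: Pi) in
  (0 < n)%N ->
  spd Amu ->
  orth_projector_onto_range (Amu *m Omega) Pi ->
  1 <= rho ->
  rho^-1 * lambda_min Amu <= tau <= rho * spectral_norm E ->
  (cond (Amu *m P) <= (rho * (spectral_norm E / lambda_min Amu))%:E)%E.
Proof.
move=> Amu E P n0 Aspd [PiPi PiT _] rho1 /andP[tau_ge tau_le].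
have lam0 := spd_lambda_min_gt0 n0 Aspd.
have [_ lamP] := lambda_min_rayleigh n0 Aspd.1.
set lam := lambda_min Amu in tau_ge lam0 lamP *.
pose Q := 1%:M - Pi.
have QT : Q^T = Q by rewrite linearB /= trmx1 PiT.
have QPi : Q *m Pi = 0 by rewrite mulmxBl mul1mx PiPi subrr.
have QQ : Q *m Q = Q by rewrite {2}/Q mulmxBr mulmx1 QPi subr0.
have EQ : E *m Q = E by rewrite /E -/Q -mulmxA QQ.
have QE : Q *m E = E by rewrite /E -/Q !mulmxA QQ.
have EP : Amu *m P = E + tau *: Pi by rewrite mulKVmx // spd_unitmx.
set e := spectral_norm E in tau_le *.
have EleP x : enorm (E *m x) <= e * enorm x by exact: enorm_mulmx_le_spectral_norm.
have EgeP x : lam * enorm (Q *m x) <= enorm (E *m x).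
  have [->|/enorm_gt0 y0] := eqVneq (Q *m x) 0; first by rewrite enorm0 mulr0 enorm_ge0.
  rewrite -(ler_pM2r y0) -mulrA -expr2; apply: le_trans (lamP _) _.
  have -> : (Q *m x)^T *m Amu *m (Q *m x) = (Q *m x)^T *m (E *m x).
    by rewrite trmx_mul QT /E -/Q !mulmxA -(mulmxA _ Q Q) QQ.
  by rewrite mulrC; exact: dot_enorm_le.
have tau0 : 0 < tau by apply: lt_le_trans tau_ge; rewrite mulr_gt0 // invr_gt0; lra.
(* From [0 < tau <= rho * e]; this is what makes [Q] nonzero below. *)
have e0 : 0 < e by rewrite -(pmulr_rgt0 e (x := rho)); lra.
have [z Qz0] : exists z : 'cV_n, Q *m z != 0.
  have /existsP[j /eqP/eqP Qj0] : [exists j, col j Q != 0].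
    apply: contraTT e0; rewrite negb_exists => /forallP Qj0.
    have Q0 : Q = 0.
      apply/matrixP => i j; have /negbNE/eqP/colP/(_ i) := Qj0 j.
      by rewrite !mxE.
    have E0 : E = 0 by rewrite -EQ Q0 mulmx0.
    rewrite -leNgt /e E0; apply: ge_sup.
      by exists 0, 0 => //=; rewrite ?enorm0 // mulmx0 enorm0.
    by move=> _ [x _ <-]; rewrite mul0mx enorm0.
  by exists (delta_mx j 0); rewrite -colE.
(* Compare both estimates of [|E y|] at [y = Q z], which [Q] fixes. *)
have lam_le_e : lam <= e.
  have z0 := enorm_gt0 Qz0; rewrite -(ler_pM2r z0).
  by apply: le_trans (EleP _); rewrite -{1}QQ -mulmxA EgeP.
(* Pythagoras on both sides: [Q x] is orthogonal to [Pi x], and [E x], lying in the range of [Q], to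
   [tau *: Pi x]. The squares are then compared summand by summand. *)
have bounds x : Num.min lam tau * enorm x <= enorm ((E + tau *: Pi) *m x)
    <= Num.max e tau * enorm x.
  have xE : enorm x ^+ 2 = enorm (Q *m x) ^+ 2 + enorm (Pi *m x) ^+ 2.
    rewrite -sqr_enormD; last by rewrite trmx_mul QT -mulmxA (mulmxA Q) QPi mul0mx mulmx0.
    by rewrite -mulmxDl subrK mul1mx.
  have ME : enorm ((E + tau *: Pi) *m x) ^+ 2
      = enorm (E *m x) ^+ 2 + (tau * enorm (Pi *m x)) ^+ 2.
    rewrite mulmxDl sqr_enormD; last first.
      rewrite -{1}QE -mulmxA trmx_mul QT -scalemxAl -scalemxAr -mulmxA.
      by rewrite (mulmxA Q) QPi mul0mx mulmx0 scaler0.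
    by rewrite -scalemxAl enormZ gtr0_norm.
  (* [E = E Q] sharpens the upper bound from [|x|] to [|Q x|], as the splitting requires. *)
  have lo := EgeP x; have hi : enorm (E *m x) <= e * enorm (Q *m x).
    by rewrite -{1}EQ -mulmxA EleP.
  have Qx := enorm_ge0 (Q *m x); have Px := enorm_ge0 (Pi *m x).
  have m0 : 0 <= Num.min lam tau by rewrite le_min !ltW.
  have M0 : 0 <= Num.max e tau by rewrite le_max (ltW e0).
  apply/andP; split; rewrite -(ler_pXn2r (n := 2)) ?nnegrE ?mulr_ge0 ?enorm_ge0 //.
    rewrite exprMn xE ME mulrDr -!exprMn lerD // ler_pXn2r ?nnegrE ?mulr_ge0 ?enorm_ge0 ?(ltW tau0) //.
      by apply: le_trans lo; rewrite ler_wpM2r // ge_min lexx.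
    by rewrite ler_wpM2r // ge_min lexx orbT.
  rewrite exprMn xE ME mulrDr -!exprMn lerD // ler_pXn2r ?nnegrE ?mulr_ge0 ?enorm_ge0 ?(ltW tau0) //.
    by apply: le_trans hi _; rewrite ler_wpM2r // le_max lexx.
  by rewrite ler_wpM2r // le_max lexx orbT.
rewrite EP; apply: le_trans (cond_le n0 _ bounds) _; first by rewrite lt_min lam0.
rewrite lee_fin mulrA ler_pdivrMr ?lt_min ?lam0 // mulrAC ler_pdivlMr //.
have rho0 : 0 < rho by lra.
have lam_tau : lam <= rho * tau by rewrite mulrC -ler_pdivrMr // mulrC.
have e_le : e <= rho * e by nra.
(* The goal is now [max e tau * lam <= rho * e * min lam tau]. The four cases use in turn [tau_le],
   the contradiction [tau < lam <= e <= tau], [e_le] and [lam_tau]. *)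
case: (leP e tau) => etau; case: (leP lam tau) => ltau.
- by rewrite ler_pM2r.
- by have := lt_le_trans ltau (le_trans lam_le_e etau); rewrite ltxx.
- by rewrite ler_pM2r.
- by rewrite mulrAC mulrC ler_pM2r.
Qed.
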